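(* If $X$ is a $T_1$ space such that the Alexandroff duplicate $AD(X)$ is star-Lindelöf, then $e(X)\leq\omega$.
   Context: The Alexandroff duplicate of $X$ is $AD(X)=X\times\{0,1\}$ topologized as follows: each point of $X\times\{1\}$ is isolated, and a basic neighbourhood of $(x,0)\in X\times\{0\}$ is a set of the form $(U\times\{0\})\cup((U\times\{1\})\setminus\{(x,1)\})$, where $U$ is a neighbourhood of $x$ in $X$. For a subset $A$ of a space $Z$ and a collection $\mathcal{P}$ of subsets of $Z$, $St(A,\mathcal{P})=\bigcup\{B\in\mathcal{P}: A\cap B\neq\emptyset\}$. A space $Z$ is star-Lindelöf if for every open cover $\mathcal{U}$ of $Z$ there is a countable $\mathcal{V}\subseteq\mathcal{U}$ such that $St(\bigcup\mathcal{V},\mathcal{U})=Z$. The extent of $X$ is $e(X)=\sup\{|Y|: Y \text{ is a closed and discrete subspace of } X\}$. *)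

(* Defs.v *)
From HB Require Import structures.
From mathcomp Require Import all_boot all_order.
From mathcomp Require Import all_classical all_analysis.

Set Implicit Arguments.
Unset Strict Implicit.
Unset Printing Implicit Defensive.

Local Open Scope classical_set_scope.
Local Open Scope card_scope.

(* An alias of [X * bool], so that it does not inherit the product topology;
   [(x, false)] and [(x, true)] encode (x, 0) and (x, 1). *)
Definition alexandroff_duplicate (X : Type) : Type := (X * bool)%type.

Section AlexandroffDuplicate.
Context {X : topologicalType}.
Local Notation AD := (alexandroff_duplicate X).

Definition alexandroff_basic_nbhs (x : X) (U : set X) : set AD :=
  (U `*` [set false]) `|` ((U `*` [set true]) `\ (x, true)).

(* A set is open when it contains a basic neighbourhood of each of its points;
   the points (x, 1) impose no condition. This is a topology for every [X], but
   the basic sets are neighbourhoods only when [X] is T1: see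
   [nbhs_alexandroff_false] below. *)
Definition alexandroff_open : set_system AD := [set O |
  forall x, O (x, false) ->
    exists2 U, nbhs x U & alexandroff_basic_nbhs x U `<=` O].

Let alexandroff_openT : alexandroff_open setT.
Proof. by move=> x _; exists setT; first exact: filterT. Qed.

Let alexandroff_openI : setI_closed alexandroff_open.
Proof.
move=> A B oA oB x [/oA[U nU UA] /oB[V nV VB]].
exists (U `&` V); first exact: filterI.
by move=> [y b] [[[/= Uy Vy] /= bE]|[[[/= Uy Vy] /= bE] ne]];
  split; (apply: UA || apply: VB); (by left) || (by right).
Qed.

Let alexandroff_open_bigU (I : Type) (f : I -> set AD) :
  (forall i, alexandroff_open (f i)) -> alexandroff_open (\bigcup_i f i).
Proof.
move=> of_ x [i _ fx]; have [U nU Uf] := of_ i x fx.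
by exists U => // p /Uf fp; exists i.
Qed.

HB.instance Definition _ := Choice.on AD.
HB.instance Definition _ := @isOpenTopological.Build AD
  alexandroff_open alexandroff_openT alexandroff_openI alexandroff_open_bigU.

Lemma open_alexandroffE : @open AD = alexandroff_open.
Proof. by []. Qed.

Lemma open_alexandroff_true (x : X) : open ([set (x, true)] : set AD).
Proof. by rewrite open_alexandroffE => y []. Qed.

Lemma nbhs_alexandroff_false (x : X) : accessible_space X ->
  nbhs ((x, false) : AD) = filter_from (nbhs x) (alexandroff_basic_nbhs x).
Proof.
move=> T1; apply/seteqP; split => A.
  rewrite [nbhs (_ : AD)]nbhsE => -[B [oB Bx] BA].
  by have [U nU UB] := oB x Bx; exists U => // p /UB /BA.
move=> [U]; rewrite [in X in X -> _]nbhsE => -[V [oV Vx] VU] UA.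
rewrite nbhsE; exists (alexandroff_basic_nbhs x V); last first.
  move=> [y b] yV; apply: UA.
  case: yV => [[/= Vy bE]|[[/= Vy bE] ne]]; [left|right].
    by split => //=; exact: VU.
  by split => //; split => //=; exact: VU.
split; last by left.
rewrite open_alexandroffE => y [[/= Vy _]|[[]]//].
have [<-|xy] := pselect (x = y).
  by exists V => //; exact: open_nbhs_nbhs.
exists (V `\ x).
  apply: open_nbhs_nbhs; split; last by split => // /esym.
  rewrite setDE; apply: openI => //; apply: closed_openC.
  exact: accessible_closed_set1.
move=> [z b] [[/= [Vz zx] bE]|[[/= [Vz zx] bE] ne]]; [by left|right].
by split => // -[].
Qed.

End AlexandroffDuplicate.

Section StarLindelof.
Context {Z : topologicalType}.

Definition open_cover (U : set_system Z) :=
  U `<=` open /\ \bigcup_(B in U) B = setT.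

Definition star (A : set Z) (P : set_system Z) : set Z :=
  \bigcup_(B in [set B | P B /\ A `&` B !=set0]) B.

End StarLindelof.

Definition star_lindelof (Z : topologicalType) :=
  forall U : set_system Z, open_cover U ->
  exists V : set_system Z,
    [/\ V `<=` U, countable V & star (\bigcup_(B in V) B) U = setT].

(* Any family of cardinals has a least member: take a maximal set [D] of
   choice functions on which every projection is injective. Some projection
   maps [D] onto [K i], for otherwise [D] could be extended. *)
Lemma card_least (I : Type) (i0 : I) (T : I -> Type) (K : forall i, set (T i)) :
  exists i, forall j, K i #<= K j.
Proof.
have [[i Ki]|K0] := pselect (exists i, K i = set0).
  by exists i => j; rewrite Ki.
have {}K0 i : exists x, K i x.
  by apply/set0P/eqP => Ki; apply: K0; exists i.
pose P (D : set (forall i, T i)) := (forall f i, D f -> K i (f i)) /\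
  forall f g i, D f -> D g -> f i = g i -> f = g.
have [|D [[DK Dinj] Dmax]] := @Zorn_bigcup _ P.
  move=> F FP Ftot; split => [f i [D FD Df]|f g i [D FD Df] [E FE Eg] fg].
    exact: (FP _ FD).1.
  have [DE|ED] := Ftot _ _ FD FE.
    by have [_ Einj] := FP _ FE; apply: Einj fg => //; exact: DE.
  by have [_ Dinj] := FP _ FD; apply: Dinj fg => //; exact: ED.
suff [i Di] : exists i, K i `<=` [set f i | f in D].
  exists i => j; apply: (card_le_trans (subset_card_le Di)).
  apply: (card_le_trans (card_image_le _ _)).
  have Dj : [set f j | f in D] #= D.
    by apply: inj_card_eq => f g /set_mem Df /set_mem Dg; exact: Dinj.
  rewrite -(card_le_eql Dj); apply: subset_card_le.
  by move=> _ [f Df <-]; exact: DK.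
apply: contrapT => /forallNP nD.
have h i : {x | K i x /\ ~ [set f i | f in D] x}.
  apply: cid; apply: contrapT => /forallNP nx; apply: (nD i) => x Kx.
  by apply: contrapT => Dx; exact: (nx x).
pose g i := sval (h i).
have Kg i : K i (g i) := (svalP (h i)).1.
have nDg f i : D f -> f i <> g i.
  by move=> Df fg; apply: (svalP (h i)).2; exists f.
apply: (Dmax (D `|` [set g])).
  split; first by move=> f Df; left.
  by move/(_ g (or_intror erefl)) => /(nDg _ i0).
split => [f i [/DK//|->//]|f1 f2 i [D1|->] [D2|->] // fE].
- exact: Dinj fE.
- by case: (nDg _ _ D1 fE).
- by case: (nDg _ _ D2 (esym fE)).
Qed.

Section Extent.
Context (X : topologicalType).

Definition discrete_subspace (Y : set X) :=
  forall y : set_type Y, open [set y].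

Definition bounds_closed_discrete (T : Type) (K : set T) :=
  forall Y : set X, closed Y -> discrete_subspace Y -> Y #<= K.

Definition is_extent (K : set X) :=
  bounds_closed_discrete K /\
  forall (T : Type) (K' : set T), bounds_closed_discrete K' -> K #<= K'.

Lemma is_extent_exists : exists K, is_extent K.
Proof.
pose I := {K : set X | bounds_closed_discrete K}.
have bT : bounds_closed_discrete [set: X] by move=> Y _ _; exact: card_leT.
have [[K bK] Kmin] :=
  @card_least I (exist _ _ bT) (fun=> X) (fun i => sval i).
exists K; split => // T K' bK'.
have [b bmin] := @card_least bool true (fun b => if b then T else X)
  (fun b => if b return set (if b then T else X) then K' else K).
case: b bmin => [/(_ false)/= K'K|/(_ true)//].
have /card_subP[C CK' _] := K'K.
have bC : bounds_closed_discrete C.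
  by move=> Y cY dY; rewrite (card_le_eqr CK'); exact: bK'.
by rewrite -(card_le_eqr CK'); exact: (Kmin (exist _ C bC)).
Qed.

(* The cardinal e(X) = sup {|Y| : Y closed discrete in X}, given by a subset of
   [X] of that cardinality (one exists because e(X) <= |X|); only its
   cardinality is meaningful. *)
Definition extent : set X := sval (cid is_extent_exists).

Lemma extentP : is_extent extent.
Proof. exact: svalP. Qed.

End Extent.

Arguments extent : clear implicits.

(* Main.v *)
Require Import Defs.
From mathcomp Require Import all_boot all_order.
From mathcomp Require Import all_classical all_analysis.

(* If [Y] is closed and discrete in [X], then [Y x {1}] is closed in [AD(X)]:
   the basic neighbourhoods of (y, 0) omit (y, 1). As its points are isolated,
   it is covered by its singletons, which together with its complement form an
   open cover of [AD(X)]. A point of [Y x {1}] is only in its own singleton, so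
   this singleton belongs to any subfamily whose star is the whole space. *)

Local Open Scope classical_set_scope.
Local Open Scope card_scope.

Lemma star_lindelof_countable_isolated (Z : topologicalType) (D : set Z) :
  star_lindelof Z -> closed D -> (forall z, D z -> open [set z]) ->
  countable D.
Proof.
move=> sL cD oD; pose U := [set set1 z | z in D] `|` [set ~` D].
have coverU : open_cover U.
  split=> [_ [[z Dz <-]|->]|]; [exact: oD|exact: closed_openC|].
  apply/seteqP; split=> // z _; have [Dz|nDz] := pselect (D z).
    by exists [set z] => //; left; exists z.
  by exists (~` D) => //; right.
have U1 B z : D z -> U B -> B z -> B = [set z].
  by move=> Dz [[t _ <-] /= ->//|->].
have [V [VU cV starV]] := sL U coverU.
apply: sub_countable cV.
(* [D] has as many points as singletons, so it suffices that [V] contains [[set z]] for each [z] in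
   [D]. *)
have inj1 : {in D &, injective (fun z : Z => [set z])}.
  by move=> s t _ _ st; have : [set s] s by []; rewrite st.
rewrite -(card_le_eql (inj_card_eq inj1)); apply: subset_card_le.
move=> _ [z Dz <-]; have : [set: Z] z by [].
(* The member [B] through [z] must be [[set z]], so the point [t] it shares with some [C] in [V] is
   [z], which forces [C] to be [[set z]]. *)
rewrite -starV => -[B [UB [t [[C VC Ct] Bt]]] Bz].
move: Bt; rewrite (U1 B z Dz UB Bz) => /= tz.
by rewrite -(U1 C z Dz (VU C VC)) // -tz.
Qed.

Lemma closed_alexandroff_discrete (X : topologicalType) (Y : set X) :
  closed Y -> discrete_subspace Y ->
  closed (Y `*` [set true] : set (alexandroff_duplicate X)).
Proof.
move=> cY dY; rewrite -openC open_alexandroffE => x _.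
have [Yx|nYx] := pselect (Y x); last first.
  exists (~` Y); first by apply: open_nbhs_nbhs; split=> //; exact: closed_openC.
  by move=> [y b] [[/= nYy _]|[[/= nYy _] _]] [].
(* Discreteness gives an open [B] of [X] that meets [Y] only in [x]; the basic neighbourhood of
   [(x, false)] built on [B] drops [(x, true)]. *)
have [B oB BE] := dY (SigSub (mem_set Yx)).
have By (y : X) (Yy : Y y) : B y -> y = x.
  move=> By; have : (set_val @^-1` B) (SigSub (mem_set Yy)) by [].
  by rewrite BE => /(congr1 set_val).
exists B.
  apply: open_nbhs_nbhs; split=> //.
  suff : (set_val @^-1` B) (SigSub (mem_set Yx)) by [].
  by rewrite BE.
move=> [y b] [[/= _ ->] []//|[[/= Bby ->] ne] [/= Yy _]].
by apply: ne; rewrite (By y).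
Qed.

Theorem theorem4p7 (X : topologicalType) (XT1 : accessible_space X)
    (ADsL : star_lindelof (alexandroff_duplicate X)) :
  extent X #<= [set: nat].
Proof.
(* The extent is a least upper bound, so bounding each closed discrete [Y] suffices. *)
apply: (extentP X).2 => Y cY dY.
have inj : {in Y &, injective (fun x : X => (x, true))}.
  by move=> x y _ _ [].
rewrite -(card_le_eql (inj_card_eq inj)).
apply: (@sub_countable _ _ _ (Y `*` [set true])).
  by apply: subset_card_le => _ [x Yx <-].
apply: (@star_lindelof_countable_isolated (alexandroff_duplicate X)) => //.
  exact: closed_alexandroff_discrete.
by move=> [x _] [/= _ ->]; exact: open_alexandroff_true.
Qed.
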